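(* Let $\rho>0$. There exists a twice continuously differentiable function $f:\mathbb{R}\to\mathbb{R}$ such that $f'$ is $\rho$-order Lipschitz continuous but $f'$ is not globally Lipschitz continuous.
   Context: A continuous function $D:\mathbb{R}\to\mathbb{R}$ is $\rho$-order Lipschitz continuous if there exist constants $C_0,C_1\ge 0$ and, for every $x\in\mathbb{R}$, there exists an open ball (interval) $B_x$ around $x$ (centered at $x$, of positive radius), such that $$|D(x_1)-D(x_2)|\le \left(C_0+C_1|D(x)|^{\rho}\right)|x_1-x_2|\quad\text{for all }x_1,x_2\in B_x.$$ The constants $C_0,C_1$ do not depend on $x$. $D$ is globally Lipschitz continuous if there exists a constant $C\ge 0$ such that $|D(x_1)-D(x_2)|\le C|x_1-x_2|$ for all $x_1,x_2\in\mathbb{R}$. *)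

(* Defs.v *)
From HB Require Import structures.
From mathcomp Require Import all_boot all_order all_algebra.
From mathcomp Require Import all_classical all_reals all_analysis.
Set Implicit Arguments.
Unset Strict Implicit.
Unset Printing Implicit Defensive.
Import Order.TTheory GRing.Theory Num.Theory.
Import numFieldNormedType.Exports.
Local Open Scope ring_scope.
Local Open Scope classical_set_scope.

(* powR a r is expR (r * ln a) for a > 0, and 0 `^ r = 0 for r != 0; so for
   rho > 0 the term `|D x| `^ rho has its usual value also where D x = 0. *)
Definition rho_order_lipschitz (R : realType) (rho : R) (D : R -> R) : Prop :=
  continuous D /\
  exists C0 C1 : R, [/\ 0 <= C0, 0 <= C1 &
    forall x : R, exists2 r : R, 0 < r &
      (C0 + C1 * `|D x| `^ rho).-lipschitz_(ball x r) D].

Definition globally_lipschitz (R : realType) (D : R -> R) : Prop :=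
  exists2 C : R, 0 <= C & C.-lipschitz D.

Definition twice_continuously_differentiable (R : realType) (f : R -> R) :
    Prop :=
  [/\ forall x : R, derivable f x 1,
      forall x : R, derivable f^`() x 1 &
      continuous f^`()^`()].

(* Main.v *)
(** The witness is [f x = (1 + x^2)^(1 + rho/2) / (2 + rho)], so that
    [f' x = x (1 + x^2)^(rho/2)] and
    [f'' x = (1 + x^2)^(rho/2) + rho x^2 (1 + x^2)^(rho/2 - 1)], whence
    [|f'' x| <= (1 + rho) (1 + x^2)^(rho/2)]. As [|x| <= |f' x|], the factor
    [(1 + x^2)^(rho/2)] is at most [2^(rho/2) (1 + |f' x|^rho)], and the mean
    value theorem gives the local Lipschitz bound. On the other hand
    [(f' x - f' 0) / x >= x^rho] is unbounded for [x > 0]. *)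
Require Import Defs.
From HB Require Import structures.
From mathcomp Require Import all_boot all_order all_algebra.
From mathcomp Require Import all_classical all_reals all_analysis.
From mathcomp Require Import ring.
Import Order.TTheory GRing.Theory Num.Theory.
Import numFieldNormedType.Exports.
Local Open Scope ring_scope.
Local Open Scope classical_set_scope.

Lemma is_derive1_continuous {R : realType} (f : R -> R) (x df : R) :
  is_derive x 1 f df -> {for x, continuous f}.
Proof. by case=> fx _; exact/differentiable_continuous/derivable1_diffP. Qed.

(** By the mean value theorem on [[a, b]], which lies in [A] because [A] is an interval; the bound
    is symmetric in the two points, so [a < b] may be assumed. *)
Lemma is_derive_lipschitz {R : realType} (A : set R) (k : R) (f df : R -> R) :
  is_interval A -> (forall y : R, A y -> is_derive y 1 f (df y)) ->
  (forall y, A y -> `|df y| <= k) -> k.-lipschitz_A f.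
Proof.
move=> iA fdf dfk.
suff H : forall a b, A a -> A b -> a < b -> `|f b - f a| <= k * `|b - a|.
  move=> [a b] [/= Aa Ab]; have [ab|ba|->] := ltgtP a b.
  - by rewrite distrC [X in _ * X]distrC; exact: H.
  - exact: H.
  - by rewrite !subrr normr0 mulr0.
move=> a b Aa Ab ab.
have Aab c : a <= c <= b -> A c by move=> /(iA _ _ Aa Ab).
have [||c] := @MVT _ f df a b ab.
- move=> c; rewrite in_itv/= => /andP[ac cb]; apply/fdf/Aab.
  by rewrite !ltW.
- by apply: derivable_within_continuous => c; rewrite in_itv/= => /Aab /fdf [].
rewrite in_itv/= => /andP[ac cb] ->.
by rewrite normrM ler_wpM2r// dfk//; apply: Aab; rewrite !ltW.
Qed.

(** Continuity of [dD] keeps [dD y] within 1 of [dD x] on a small ball around [x]. Adding this 1 to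
    [C0] gives constants independent of [x], with the bound evaluated only at the centre. *)
Lemma rho_order_lipschitz_is_derive {R : realType} (rho C0 C1 : R)
    (D dD : R -> R) :
  0 <= C0 -> 0 <= C1 -> continuous dD ->
  (forall x : R, is_derive x 1 D (dD x)) ->
  (forall x, `|dD x| <= C0 + C1 * `|D x| `^ rho) ->
  rho_order_lipschitz rho D.
Proof.
move=> C00 C10 cdD DdD dDle; split.
  by move=> x; exact: (is_derive1_continuous _ _ _ (DdD x)).
exists (C0 + 1), C1; split; [by rewrite addr_ge0|by []|move=> x].
have /cvgrPdist_lt/(_ 1 ltr01)/nbhs_ballP[r/= r0 rdD] := cdD x.
exists r => //; apply: (is_derive_lipschitz _ _ _ dD) => //.
  by rewrite ball_itv; exact: interval_is_interval.
move=> y /rdD/= dist1; rewrite addrAC.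
rewrite -(subrK (dD x) (dD y)) (le_trans (ler_normD _ _))// addrC.
by rewrite lerD// distrC ltW.
Qed.

Lemma is_derive_powR_sqr {R : realType} (a x : R) :
  is_derive x 1 (fun y : R => (1 + y ^+ 2) `^ a)
    (2 * a * x * (1 + x ^+ 2) `^ (a - 1)).
Proof.
have h0 : 0 < 1 + x ^+ 2 :> R by rewrite ltr_pwDl ?sqr_ge0.
have dh : is_derive x 1 (fun y : R => 1 + y ^+ 2) (2 * x).
  by apply: is_derive_eq; rewrite add0r /GRing.scale/=; ring.
have dp := is_derive1_powR a h0.
have d := @is_derive1_comp _ _ (fun y => 1 + y ^+ 2) _ _ _ dp dh.
by apply: (is_derive_eq d); ring.
Qed.

Lemma continuous_powR_sqr {R : realType} (a : R) :
  continuous (fun y : R => (1 + y ^+ 2) `^ a).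
Proof.
by move=> x; exact: (is_derive1_continuous _ _ _ (is_derive_powR_sqr a x)).
Qed.

Theorem proposition4 (R : realType) (rho : R) (hrho : 0 < rho) :
  exists f : R -> R,
    [/\ twice_continuously_differentiable f,
        rho_order_lipschitz rho f^`() &
        ~ globally_lipschitz f^`()].
Proof.
pose h (x : R) := 1 + x ^+ 2.
have h_gt0 x : 0 < h x by rewrite ltr_pwDl ?sqr_ge0.
have h_ge1 x : 1 <= h x by rewrite lerDl sqr_ge0.
have [q q0 q2] : exists2 q, 0 < q & 2 * q = rho.
  by exists (rho / 2); [rewrite divr_gt0|field].
pose f x := (2 * (q + 1))^-1 * h x `^ (q + 1).
pose D x := x * h x `^ q.
pose dD x := h x `^ q + 2 * q * x ^+ 2 * h x `^ (q - 1).
have fD (x : R) : is_derive x 1 f (D x).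
  have d := is_derive_powR_sqr (q + 1) x.
  apply: (is_derive_eq (is_deriveZ (2 * (q + 1))^-1 d)).
  rewrite /GRing.scale/= addrK /D -/(h x); field.
  by rewrite gt_eqF// addr_gt0.
have DdD (x : R) : is_derive x 1 D (dD x).
  have d := is_derive_powR_sqr q x.
  apply: (is_derive_eq (is_deriveM (is_derive_id x 1) d)).
  by rewrite /GRing.scale/= /dD -/(h x); ring.
have f1 : f^`() = D.
  by apply/funext => x; rewrite derive1E derive_val.
have f2 : D^`() = dD.
  by apply/funext => x; rewrite derive1E derive_val.
have cdD : continuous dD.
  move=> x; apply: cvgD; first exact: continuous_powR_sqr.
  apply: cvgM; last exact: continuous_powR_sqr.
  by apply: cvgM; [exact: cvg_cst|exact: exprn_continuous].
have sqr_powR (x : R) : (x ^+ 2) `^ q = `|x| `^ rho.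
  by rewrite -real_normK ?num_real// -powR_mulrn// -powRrM q2.
have D_ge x : `|x| <= `|D x|.
  rewrite normrM ler_peMr// ger0_norm ?powR_ge0//.
  by rewrite -[leLHS](@powRr0 _ (h x)) ler_powR// ltW.
have hq_le x : h x `^ q <= 2 `^ q * (1 + `|D x| `^ rho).
  (* If [|x| <= 1] then [h x <= 2], and the first summand suffices. Otherwise [h x <= 2 * x ^+ 2],
     whose [q]-th power is [2 ^ q * |x| ^ rho], and [D_ge] bounds this by the second. *)
  rewrite mulrDr mulr1; have [x1|x1] := leP `|x| 1.
    rewrite -[leLHS]addr0 lerD ?mulr_ge0 ?powR_ge0// ge0_ler_powR ?nnegrE//.
    - exact: ltW.
    - exact: ltW.
    - by rewrite /h -real_normK ?num_real// lerD2l expr_le1.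
  rewrite -[leLHS]add0r lerD ?powR_ge0//.
  apply: (@le_trans _ _ ((2 * x ^+ 2) `^ q)).
    apply: ge0_ler_powR; rewrite ?nnegrE; [exact: ltW|exact: ltW| |].
      by apply: mulr_ge0 => //; exact: sqr_ge0.
    rewrite /h mulr_natl mulr2n lerD2r -real_normK ?num_real//.
    by rewrite exprn_ege1// ltW.
  rewrite powRM ?sqr_ge0// sqr_powR ler_wpM2l ?powR_ge0//.
  by rewrite ge0_ler_powR ?nnegrE// ltW.
have dD_le x : `|dD x| <= (1 + rho) * h x `^ q.
  rewrite ger0_norm; last first.
    apply: addr_ge0; rewrite ?powR_ge0// mulr_ge0 ?powR_ge0//.
    by rewrite mulr_ge0 ?sqr_ge0// mulr_ge0// ltW.
  (* Factoring one [h x] out of the power leaves [x ^+ 2 <= h x]. *)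
  rewrite mulrDl mul1r lerD2l -(mulr_powRB1 (ltW (h_gt0 x)) q0) mulrA.
  rewrite ler_wpM2r ?powR_ge0// q2.
  by rewrite ler_wpM2l ?ltW// ltrDr.
exists f; rewrite /twice_continuously_differentiable f1 f2; split.
- by split=> // x; exact: ex_derive.
(* The product of the constants in [dD_le] and [hq_le]; it serves as both [C0] and [C1]. *)
- pose K := (1 + rho) * 2 `^ q.
  have K0 : 0 <= K by rewrite mulr_ge0 ?powR_ge0// addr_ge0 ?ltW.
  apply: (rho_order_lipschitz_is_derive _ K K _ dD) => // x.
  have -> : K + K * `|D x| `^ rho = (1 + rho) * (2 `^ q * (1 + `|D x| `^ rho)).
    by rewrite /K; ring.
  by rewrite (le_trans (dD_le x))// ler_wpM2l// addr_ge0// ltW.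
- move=> [C C0 /(_ (_, 0) (conj I I))/= CD].
  (* Chosen so that [x ^ rho = C + 1]. Since [D 0 = 0], comparing [x] with 0 and dividing by [|x|]
     would give [h x ^ q <= C], whereas [h x ^ q >= x ^ rho > C]. *)
  pose x := (C + 1) `^ rho^-1.
  have x0 : 0 < x by rewrite powR_gt0// ltr_wpDl.
  have := CD x; rewrite {2}/D mul0r !subr0 normrM mulrC.
  rewrite ler_pM2r ?normr_gt0 ?gt_eqF//.
  rewrite ger0_norm ?powR_ge0// leNgt => /negP; apply.
  apply: (@lt_le_trans _ _ ((x ^+ 2) `^ q)).
    rewrite sqr_powR ger0_norm ?ltW// /x -powRrM mulVf ?gt_eqF//.
    by rewrite powRr1 ?ltrDl// addr_ge0.
  by rewrite ge0_ler_powR ?nnegrE ?sqr_ge0 ?lerDr// ltW.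
Qed.
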